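(* Let $J^4$ be the fourfold integration operator on $L^2([0,1])$, $[J^4x](s)=\int_0^s \frac{(s-t)^3}{6}\,x(t)\,dt$ for $0\le s\le 1$. The eigenvalues $\lambda$ of the operator $(J^4)^*J^4$ are exactly the solutions $\lambda>0$ of the nonlinear transcendental equation \begin{align*} &\cos\bigl(\sqrt{2}\,\lambda^{-\frac18}\bigr)+\cosh\bigl(\sqrt{2}\,\lambda^{-\frac18}\bigr)+2\cos\bigl(\lambda^{-\frac18}\bigr)\cosh\bigl(\lambda^{-\frac18}\bigr)\\ &+3\bigl(\cos\bigl(\sqrt{2}\,\lambda^{-\frac18}\bigr)+\cosh\bigl(\sqrt{2}\,\lambda^{-\frac18}\bigr)\bigr)\cos\bigl(\lambda^{-\frac18}\bigr)\cosh\bigl(\lambda^{-\frac18}\bigr)\\ &+8\bigl(\cos\bigl(\lambda^{-\frac18}\bigr)+\cosh\bigl(\lambda^{-\frac18}\bigr)\bigr)\cos\bigl(\tfrac{1}{\sqrt2}\lambda^{-\frac18}\bigr)\cosh\bigl(\tfrac{1}{\sqrt2}\lambda^{-\frac18}\bigr)\\ &+4\sqrt2\,\sin\bigl(\lambda^{-\frac18}\bigr)\sin\bigl(\tfrac{1}{\sqrt2}\lambda^{-\frac18}\bigr)\cosh\bigl(\tfrac{1}{\sqrt2}\lambda^{-\frac18}\bigr)\\ &-4\sqrt2\,\cos\bigl(\tfrac{1}{\sqrt2}\lambda^{-\frac18}\bigr)\sinh\bigl(\lambda^{-\frac18}\bigr)\sinh\bigl(\tfrac{1}{\sqrt2}\lambda^{-\frac18}\bigr)\\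 &+2\sqrt2\,\sin\bigl(\lambda^{-\frac18}\bigr)\sin\bigl(\sqrt2\,\lambda^{-\frac18}\bigr)\cosh\bigl(\lambda^{-\frac18}\bigr)\\ &-2\sqrt2\,\cos\bigl(\lambda^{-\frac18}\bigr)\sinh\bigl(\lambda^{-\frac18}\bigr)\sinh\bigl(\sqrt2\,\lambda^{-\frac18}\bigr)+6=0. \end{align*}
   Context: $L^2([0,1])$ denotes the Hilbert space of real-valued square-integrable Lebesgue-measurable functions on $[0,1]$. $(J^4)^*$ is the Hilbert space adjoint, $[(J^4)^*z](t)=\int_t^1 \frac{(s-t)^3}{6}\,z(s)\,ds$ for $0\le t\le 1$. Fractional powers of $\lambda>0$ are the positive real ones. *)

(* Defs.v *)
From HB Require Import structures.
From mathcomp Require Import all_boot all_order all_algebra.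
From mathcomp Require Import all_classical all_reals all_analysis.
From mathcomp Require Import lra measurable_realfun.
Import Order.TTheory GRing.Theory Num.Theory.
Import numFieldNormedType.Exports.

Set Implicit Arguments.
Unset Strict Implicit.
Unset Printing Implicit Defensive.

Local Open Scope classical_set_scope.
Local Open Scope ring_scope.

Definition cosh {R : realType} (x : R) : R := (expR x + expR (- x)) / 2.
Definition sinh {R : realType} (x : R) : R := (expR x - expR (- x)) / 2.

Section L2_unit_interval.
Context {R : realType}.
Local Notation leb := (@lebesgue_measure R).
Local Notation T := (measurableTypeR R).

Lemma lebesgue_unit_lty : (leb `[0%R, 1%R]%classic < +oo)%E.
Proof. by rewrite lebesgue_measure_itv/= lte_fin ltr01 -EFinD ltry. Qed.

Definition leb01 : set (measurableTypeR R) -> \bar R :=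
  @mfrestr _ (measurableTypeR R) R _ leb (measurable_itv `[0%R, 1%R])
    lebesgue_unit_lty.

HB.instance Definition _ := FiniteMeasure.on leb01.

(* An element of $L^2([0,1])$ is represented by a measurable function on the
   line which is square-integrable for [leb01]; its values off [0, 1] are
   irrelevant, and equality in $L^2([0,1])$ is [f = g %[ae leb01]]. *)
Definition L2_01 : Type := LfunType leb01 (lee1n 2 : (1 <= 2%:E)%E).

Local Notation mu := leb01.

Definition inner (f g : L2_01) : R := \int[leb01]_t (f t * g t).

Definition is_adjoint (A B : L2_01 -> L2_01) : Prop :=
  forall f g : L2_01, inner (A f) g = inner f (B g).

Definition is_eigenvalue (A : L2_01 -> L2_01) (lambda : R) : Prop :=
  exists f : L2_01,
    ~ (f = (0 : L2_01) %[ae leb01]) /\ A f = lambda *: f %[ae leb01].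

(* The integrals are taken for the Lebesgue measure of the line; the results
   are extended by 0 off [0, 1]. *)
Definition J4_fun (x : R -> R) : R -> R :=
  (fun s => \int[leb]_(t in `[0, s]) ((s - t) ^+ 3 / 6 * x t)) \_ `[0, 1].

Definition J4adj_fun (z : R -> R) : R -> R :=
  (fun t => \int[leb]_(s in `[t, 1]) ((s - t) ^+ 3 / 6 * z s)) \_ `[0, 1].

Lemma leb01_lebesgue (f : T -> R) : measurable_fun setT f ->
  \int[mu]_x f x = \int[leb]_(x in `[0, 1]) f x.
Proof.
move=> mf; rewrite /Rintegral; congr fine.
have mu0 : mu (~` `[0, 1]%classic) = 0%E.
  by rewrite /= /leb01 /mfrestr /mrestr setICl measure0.
have mI : measurable (`[0, 1]%classic : set T) by exact: measurable_itv.
transitivity (\int[mu]_(x in `[0%R, 1%R]) (f x)%:E)%E; last first.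
  by apply: eq_measure_integral => A mA A01; rewrite /= /leb01 /mfrestr /mrestr setIidl.
rewrite integralE [RHS]integralE; congr (_ - _)%E.
- rewrite (@ge0_negligible_integral _ _ _ mu setT (~` `[0, 1]%classic))//.
  + by rewrite setTD setCK.
  + exact: measurableC.
  + by apply/measurable_funepos/measurable_EFinP.
- rewrite (@ge0_negligible_integral _ _ _ mu setT (~` `[0, 1]%classic))//.
  + by rewrite setTD setCK.
  + exact: measurableC.
  + by apply/measurable_funeneg/measurable_EFinP.
Qed.

Definition J4_kernel (s t : R) : R :=
  if (0 <= t) && (t <= s) && (s <= 1) then (s - t) ^+ 3 / 6 else 0.

Lemma J4_kernel_norm s t : `|J4_kernel s t| <= 1.
Proof.
rewrite /J4_kernel; case: ifPn => [/andP[/andP[t0 ts] s1]|_]; last by rewrite normr0.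
have st0 : 0 <= s - t by rewrite subr_ge0.
rewrite ger0_norm ?divr_ge0 ?exprn_ge0// ler_pdivrMr// mul1r.
by rewrite (@le_trans _ _ 1) ?exprn_ile1//; lra.
Qed.

Lemma measurable_J4_kernel : measurable_fun [set: T * T] (fun st => J4_kernel st.1 st.2).
Proof.
have m1 : measurable_fun [set: T * T] (fst : T * T -> R) by exact: measurable_fst.
have m2 : measurable_fun [set: T * T] (snd : T * T -> R) by exact: measurable_snd.
apply: measurable_fun_ifT => //.
- apply: measurable_and; first apply: measurable_and.
  + exact: measurable_fun_ler.
  + exact: measurable_fun_ler.
  + exact: measurable_fun_ler.
- by apply: measurable_funM => //; apply/measurable_funX/measurable_funB.
Qed.

Lemma L2_meas (x : L2_01) : measurable_fun [set: T] (x : T -> R).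
Proof. by []. Qed.

Lemma L2_integrable (x : L2_01) : mu.-integrable setT (EFin \o x).
Proof.
apply/Lfun1_integrable; apply: Lfun_subset12.
  by rewrite fin_num_measure.
exact: LfunP.
Qed.

Lemma J4_funE (x : L2_01) s : J4_fun x s = \int[mu]_t (J4_kernel s t * x t).
Proof.
have mKx : measurable_fun [set: T] (fun t => J4_kernel s t * x t).
  apply: measurable_funM => //.
  exact: (measurableT_comp measurable_J4_kernel (pair1_measurable s)).
rewrite leb01_lebesgue// /J4_fun patchE.
case: ifPn => [/[!inE]/=|/negP/[!inE]/=]; rewrite in_itv/=; last first.
  move=> s01; apply/esym; rewrite /Rintegral (eq_integral (cst 0%E)) ?integral0//.
  move=> t _; rewrite /J4_kernel; case: ifPn => [/andP[/andP[t0 ts] s1]|]; last by rewrite mul0r.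
  by exfalso; apply: s01; rewrite s1 (le_trans t0 ts).
move=> /andP[s0 s1]; rewrite Rintegral_mkcond [RHS]Rintegral_mkcond.
apply: eq_Rintegral => t _; rewrite !patchE /J4_kernel s1 andbT !mem_setE !in_itv/=.
case: (0 <= t) => //=; case: leP => // ts; first by rewrite (le_trans ts s1).
by rewrite mul0r if_same.
Qed.

Lemma J4adj_funE (x : L2_01) t : J4adj_fun x t = \int[mu]_s (J4_kernel s t * x s).
Proof.
have mKx : measurable_fun [set: T] (fun s => J4_kernel s t * x s).
  apply: measurable_funM => //.
  exact: (measurableT_comp measurable_J4_kernel (pair2_measurable t)).
rewrite leb01_lebesgue// /J4adj_fun patchE.
case: ifPn => [/[!inE]/=|/negP/[!inE]/=]; rewrite in_itv/=; last first.
  move=> t01; apply/esym; rewrite /Rintegral (eq_integral (cst 0%E)) ?integral0//.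
  move=> s _; rewrite /J4_kernel; case: ifPn => [/andP[/andP[t0 ts] s1]|]; last by rewrite mul0r.
  by exfalso; apply: t01; rewrite t0 (le_trans ts s1).
move=> /andP[t0 t1]; rewrite Rintegral_mkcond [RHS]Rintegral_mkcond.
apply: eq_Rintegral => s _; rewrite !patchE /J4_kernel t0 !mem_setE !in_itv/=.
case: (leP t s) => //= ts; last by rewrite mul0r if_same.
by rewrite (le_trans t0 ts)/=; case: ifP.
Qed.

Section kernel_op.
Variable k : R -> R -> R.
Hypothesis mk : measurable_fun [set: T * T] (fun st => k st.1 st.2).
Hypothesis k1 : forall s t, `|k s t| <= 1.

Lemma kernel_integrable (x : L2_01) s :
  mu.-integrable setT (EFin \o (fun t => k s t * x t)).
Proof.
apply: (@le_integrable _ _ _ mu setT measurableT _ (EFin \o x)) => //.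
- apply/measurable_EFinP; apply: measurable_funM => //.
  exact: (measurableT_comp mk (pair1_measurable s)).
- by move=> t _ /=; rewrite lee_fin normrM ler_piMl.
- exact: L2_integrable.
Qed.

Lemma kernel_integrable2 (x z : L2_01) :
  (mu \x mu)%E.-integrable setT
    (fun st : T * T => ((z st.1) * (k st.1 st.2 * x st.2))%:E).
Proof.
apply/integrable12ltyP.
  apply/measurable_EFinP; apply: measurable_funM.
    exact: (measurableT_comp (L2_meas z) (@measurable_fst _ _ T T)).
  apply: measurable_funM => //.
  exact: (measurableT_comp (L2_meas x) (@measurable_snd _ _ T T)).
pose M := (\int[mu]_t `|x t|%:E)%E.
have Mfin : M \is a fin_num.
  have /integrableP[_] := L2_integrable x.
  by rewrite ge0_fin_numE ?integral_ge0.
apply: (@le_lt_trans _ _ (\int[mu]_s (`|z s|%:E * M)))%E.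
  apply: ge0_le_integral => //=.
  - by move=> s _; apply: integral_ge0.
  - apply: (@measurable_fun_fubini_tonelli_F _ _ T T R mu (fun st : T * T => (`|(z st.1) * (k st.1 st.2 * x st.2)|)%:E)) => //=.
    apply/measurable_EFinP/measurableT_comp => //; apply: measurable_funM.
      exact: (measurableT_comp (L2_meas z) (@measurable_fst _ _ T T)).
    apply: measurable_funM => //.
    exact: (measurableT_comp (L2_meas x) (@measurable_snd _ _ T T)).
  - apply: emeasurable_funM => //.
    by apply/measurable_EFinP/measurableT_comp.
  - move=> s _; rewrite -ge0_integralZl//; last first.
      by apply/measurable_EFinP/measurableT_comp.
    apply: ge0_le_integral => //=.
    + apply/measurable_EFinP/measurableT_comp => //; apply: measurable_funM => //.
      apply: measurable_funM => //.
      exact: (measurableT_comp mk (pair1_measurable s)).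
    + apply: emeasurable_funM => //.
      by apply/measurable_EFinP/measurableT_comp.
    + move=> t _; rewrite lee_fin normrM ler_wpM2l//.
      by rewrite normrM ler_piMl.
rewrite ge0_integralZr//; last 2 first.
- by apply/measurable_EFinP/measurableT_comp.
- exact: integral_ge0.
have /integrableP[_ zfin] := L2_integrable z.
apply: lte_mul_pinfty; first exact: integral_ge0.
  by rewrite ge0_fin_numE ?integral_ge0.
rewrite -ge0_fin_numE.
  exact: Mfin.
exact: integral_ge0.
Qed.

Lemma one_Lfun2 : (cst 1 : T -> R) \in Lfun mu 2%:E.
Proof. exact: Lfun_cst. Qed.

Lemma kernel_Lfun2 (x : L2_01) :
  (fun s => \int[mu]_t (k s t * x t) : R) \in Lfun mu 2%:E.
Proof.
pose one : L2_01 := Lfun_Sub _ one_Lfun2.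
have mJ : measurable_fun [set: T] (fun s => \int[mu]_t (k s t * x t) : R).
  apply/measurable_EFinP.
  have := measurable_fubini_F (kernel_integrable2 x one).
  apply: eq_measurable_fun => s _; rewrite /fubini_F /Rintegral/=.
  rewrite [in RHS]fineK; last exact/integrable_fin_num/kernel_integrable.
  by apply: eq_integral => t _; rewrite mul1r.
pose M := \int[mu]_t `|x t|.
have JM s : `|\int[mu]_t (k s t * x t)| <= M.
  rewrite (le_trans (le_normr_Rintegral _ (kernel_integrable x s)))//.
  apply: le_Rintegral => //.
  - exact: (integrable_abse (kernel_integrable x s)).
  - exact: (integrable_abse (L2_integrable x)).
  - by move=> t _; rewrite normrM ler_piMl.
rewrite inE; apply/andP; split; rewrite inE//=.
have : cst M \in Lfun mu 2%:E by exact: Lfun_cst.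
rewrite inE => /andP[_]; rewrite inE/= /finite_norm; apply: le_lt_trans.
rewrite unlock; apply: gt0_ler_poweR.
- by rewrite invr_ge0.
- by rewrite in_itv/= leey andbT; apply: integral_ge0.
- by rewrite in_itv/= leey andbT; apply: integral_ge0.
apply: ge0_le_integral => //=.
- apply/measurable_EFinP.
  apply: (@measurableT_comp _ _ _ _ _ _ (@powR R ^~ 2)) => //.
  exact: measurableT_comp.
- move=> s _; rewrite lee_fin ge0_ler_powR ?nnegrE//.
  by rewrite (le_trans (JM s))// ler_norm.
Qed.
End kernel_op.

Lemma measurable_J4_kernelC :
  measurable_fun [set: T * T] (fun st => J4_kernel st.2 st.1).
Proof.
exact: (measurableT_comp measurable_J4_kernel (@measurable_swap _ _ T T)).
Qed.

Lemma J4_kernel_normC s t : `|J4_kernel t s| <= 1.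
Proof. exact: J4_kernel_norm. Qed.

Lemma J4_Lfun (x : L2_01) : (J4_fun x : T -> R) \in Lfun mu 2%:E.
Proof.
rewrite (_ : J4_fun x = fun s => \int[mu]_t (J4_kernel s t * x t)).
  exact: (kernel_Lfun2 measurable_J4_kernel J4_kernel_norm).
by apply/funext => s; exact: J4_funE.
Qed.

Lemma J4adj_Lfun (z : L2_01) : (J4adj_fun z : T -> R) \in Lfun mu 2%:E.
Proof.
rewrite (_ : J4adj_fun z = fun t => \int[mu]_s (J4_kernel s t * z s)).
  exact: (kernel_Lfun2 measurable_J4_kernelC J4_kernel_normC).
by apply/funext => s; exact: J4adj_funE.
Qed.

Definition J4 (x : L2_01) : L2_01 := Lfun_Sub _ (J4_Lfun x).

Definition J4adj (z : L2_01) : L2_01 := Lfun_Sub _ (J4adj_Lfun z).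

Lemma J4_ae_eq (x y : L2_01) : x = y %[ae mu] -> J4 x = J4 y.
Proof.
move=> xy; apply/LfuneqP => s; rewrite /= !J4_funE /Rintegral; congr fine.
have mkx := measurable_int _ (kernel_integrable measurable_J4_kernel J4_kernel_norm x s).
have mky := measurable_int _ (kernel_integrable measurable_J4_kernel J4_kernel_norm y s).
apply: ae_eq_integral => //.
by apply: filterS xy => t /= + tT => ->.
Qed.

Lemma J4adj_ae_eq (x y : L2_01) : x = y %[ae mu] -> J4adj x = J4adj y.
Proof.
move=> xy; apply/LfuneqP => t; rewrite /= !J4adj_funE /Rintegral; congr fine.
have mkx := measurable_int _ (kernel_integrable measurable_J4_kernelC J4_kernel_normC x t).
have mky := measurable_int _ (kernel_integrable measurable_J4_kernelC J4_kernel_normC y t).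
apply: ae_eq_integral => //.
by apply: filterS xy => s /= + sT => ->.
Qed.

Lemma J4_adjoint : is_adjoint J4 J4adj.
Proof.
move=> x z; rewrite /inner /Rintegral; congr fine.
transitivity (\int[mu]_s \int[mu]_t (z s * (J4_kernel s t * x t))%:E)%E.
  apply: eq_integral => s _; rewrite /= J4_funE mulrC EFinM.
  have ik := kernel_integrable measurable_J4_kernel J4_kernel_norm x s.
  rewrite /Rintegral fineK; last exact: integrable_fin_num ik.
  by rewrite -integralZl.
rewrite (Fubini (kernel_integrable2 measurable_J4_kernel J4_kernel_norm x z)).
apply: eq_integral => t _; rewrite /= J4adj_funE EFinM.
have ik := kernel_integrable measurable_J4_kernelC J4_kernel_normC z t.
rewrite /Rintegral fineK; last exact: integrable_fin_num ik.
rewrite -integralZl//; apply: eq_integral => s _ /=.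
by rewrite -EFinM [in LHS]mulrA [in LHS]mulrC [z s * _]mulrC.
Qed.

End L2_unit_interval.

(* Main.v *)
Require Import Defs.
From HB Require Import structures.
From mathcomp Require Import all_boot all_order all_algebra.
From mathcomp Require Import all_classical all_reals all_analysis.
From mathcomp Require Import ring lra measurable_realfun.
Import Order.TTheory GRing.Theory Num.Theory.
Import numFieldNormedType.Exports.
Local Open Scope classical_set_scope.
Local Open Scope ring_scope.

(** Since $(J^4)^* J^4 f = \lambda f$ forces $\lambda \|f\|^2 = \|J^4 f\|^2$,
an eigenvalue is nonnegative ([eigenvalue_ge0]); and it is not 0, because
$(J^4)^* J^4$ is injective ([J4adjJ4_injective]).

For $\lambda > 0$ put $w = \lambda^{-1/8}$. By Taylor's formula with integral
remainder, $v = J^4 x$ solves $v'''' = x$ with $v, v', v'', v'''$ zero at 0, and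
$u = (J^4)^* z$ solves $u'''' = z$ with $u, u', u'', u'''$ zero at 1
([J4_taylor], [J4adj_taylor]). An eigenfunction is therefore a solution of
$y^{(8)} = w^8 y$ with $y^{(k)}(1) = 0$ for $k < 4$ and $y^{(k)}(0) = 0$ for
$4 \le k < 8$. It is convenient to regard the rescaled derivatives
$y_k = w^{-k} y^{(k)}$ as a family indexed by $\mathbb Z/8$, for which the
equation becomes the cyclic system $y_k' = w\, y_{k+1}$.

The functions $\varphi_k(x) = \sum_n x^{8n+k} / (8n+k)!$, for $k$ in
$\mathbb Z/8$, are combinations of circular and hyperbolic functions of $x$ and
$x/\sqrt 2$ ([phi]). They satisfy $\varphi_k' = \varphi_{k-1}$ and
$\varphi_k(0) = \delta_{k0}$, hence they propagate solutions of the system: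
$y_j(t) = \sum_k \varphi_k(w(t-s))\, y_{j+k}(s)$ ([propagation]). Taking
$s = 0$ and $t = 1$, the four unknown initial values $y_0(0), ..., y_3(0)$ of an
eigenfunction are in the left kernel of the Toeplitz matrix
$(\varphi_{k-j}(w))_{k,j<4}$. So $\lambda$ is an eigenvalue if and only if this
matrix is singular ([eigenfunction_det0], [det0_eigenvalue]), and the left-hand
side of the transcendental equation is 32 times its determinant
([det_toeplitz]).

Injectivity is needed for square-integrable functions, where differentiation is
not available at once. If $(J^4)^* J^4 f = 0$, differentiating eight times the
smooth function $J^4 (J^4)^* (J^4 f) = 0$ gives $J^4 f = 0$, that is, $f$ is
orthogonal to $(s-t)_+^3$ as a function of $t$, for all $s < 1$. Third backward
differences in $s$ of these functions are bounded and converge to the indicator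
of $t < s$, so all the integrals of $f$ over $[0, s]$ vanish
([annihilates_step]), and the Lebesgue differentiation theorem gives $f = 0$. *)

Set Implicit Arguments.
Unset Strict Implicit.
Unset Printing Implicit Defensive.

(** * Hyperbolic functions and the fundamental solutions *)

Section hyperbolic_derivatives.
Context {R : realType}.
Implicit Types x : R.

Lemma cosh0 : cosh 0 = 1 :> R.
Proof. by rewrite /cosh oppr0 expR0; field. Qed.

Lemma sinh0 : sinh 0 = 0 :> R.
Proof. by rewrite /sinh oppr0 subrr mul0r. Qed.

Lemma cosh2sinh2 x : cosh x ^+ 2 = 1 + sinh x ^+ 2.
Proof.
by have e := expRxMexpNx_1 x; rewrite /cosh /sinh; field: e.
Qed.

Lemma cosh_double x : cosh (2 * x) = 2 * cosh x ^+ 2 - 1.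
Proof.
have e := expRxMexpNx_1 x; rewrite /cosh -mulrN !mulrDl !mul1r !expRD.
by field: e.
Qed.

Lemma sinh_double x : sinh (2 * x) = 2 * sinh x * cosh x.
Proof. by rewrite /sinh /cosh -mulrN !mulrDl !mul1r !expRD; field. Qed.

#[global] Instance is_derive_sinh x : is_derive x 1 sinh (cosh x).
Proof.
rewrite /sinh /cosh; apply: is_derive_eq.
by rewrite /GRing.scale/=; ring.
Qed.

#[global] Instance is_derive_cosh x : is_derive x 1 cosh (sinh x).
Proof.
rewrite /sinh /cosh; apply: is_derive_eq.
by rewrite /GRing.scale/=; ring.
Qed.

End hyperbolic_derivatives.

Section fundamental_solutions.
Context {R : realType}.
Implicit Types x w : R.
Local Notation r := (1 / Num.sqrt 2 : R).

(** Closed forms of the sections $\sum_n x^{8n+k} / (8n+k)!$ of the exponential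
series, obtained by averaging $\omega^{-k} e^{\omega x}$ over the eighth roots of
unity $\omega$; the primitive ones give the functions of $x / \sqrt 2$. *)
Definition phi (k : 'Z_8) x : R :=
  [:: (cosh x + cos x + 2 * (cosh (r * x) * cos (r * x))) / 4;
      (sinh x + sin x
        + 2 * r * (cosh (r * x) * sin (r * x) + sinh (r * x) * cos (r * x))) / 4;
      (cosh x - cos x + 2 * (sinh (r * x) * sin (r * x))) / 4;
      (sinh x - sin x
        + 2 * r * (cosh (r * x) * sin (r * x) - sinh (r * x) * cos (r * x))) / 4;
      (cosh x + cos x - 2 * (cosh (r * x) * cos (r * x))) / 4;
      (sinh x + sin x
        - 2 * r * (cosh (r * x) * sin (r * x) + sinh (r * x) * cos (r * x))) / 4;
      (cosh x - cos x - 2 * (sinh (r * x) * sin (r * x))) / 4;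
      (sinh x - sin x
        - 2 * r * (cosh (r * x) * sin (r * x) - sinh (r * x) * cos (r * x))) / 4
  ]`_k.

Lemma inv_sqrt2 : r = Num.sqrt 2 / 2.
Proof.
have d0 : Num.sqrt 2 != 0 :> R by rewrite gt_eqF// sqrtr_gt0.
by apply: (mulIf d0); rewrite divfK// mulrAC -expr2 sqr_sqrtr// divff.
Qed.

#[global] Instance is_derive_phi k x : is_derive x 1 (phi k) (phi (k - 1) x).
Proof.
rewrite /phi inv_sqrt2; have : (Num.sqrt 2 : R) ^+ 2 = 2 by rewrite sqr_sqrtr.
move: (Num.sqrt 2) => d d2.
case: k => [] [|[|[|[|[|[|[|[|//]]]]]]]] i /=; apply: is_derive_eq;
  by rewrite /phi /GRing.scale/=; field: d2.
Qed.

Lemma phi0 k : phi k 0 = (k == 0)%:R.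
Proof.
rewrite /phi mulr0 cosh0 sinh0 cos0 sin0.
by case: k => [] [|[|[|[|[|[|[|[|//]]]]]]]] i /=; field.
Qed.

(** Its entry $(k, j)$ is the contribution of the initial value $y_k(0)$ to
$y_j(1)$, in the notation of [propagation]; the difference is taken modulo 8. *)
Definition toeplitz x : 'M[R]_4 :=
  \matrix_(k, j) phi ((k : nat)%:R - (j : nat)%:R) x.

(** Expansion along the first row for a matrix given by its entries as a function
of two natural numbers: it evaluates to a polynomial expression in the entries
by mere reduction, unlike the determinant. *)
Fixpoint laplace n (F : nat -> nat -> R) : R :=
  if n isn't n'.+1 then 1 else
  foldr +%R 0 [seq (-1) ^+ j * F 0%N j *
                   laplace n' (fun i k => F i.+1 (bump j k)) | j <- iota 0 n].

Lemma det_laplace n (F : nat -> nat -> R) :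
  \det (\matrix_(i < n, j < n) F i j) = laplace n F.
Proof.
elim: n F => [|n IH] F; first by rewrite det_mx00.
transitivity (\sum_(0 <= j < n.+1) (-1) ^+ j * F 0%N j *
    laplace n (fun i k => F i.+1 (bump j k))); last first.
  by rewrite /index_iota subn0 -(big_map _ xpredT id) -foldrE.
rewrite (expand_det_row _ ord0) big_mkord; apply: eq_bigr => j _.
rewrite mxE /cofactor add0n -IH mulrCA mulrA; congr (_ * \det _).
by apply/matrixP => i k; rewrite !mxE.
Qed.

(** Once the angles $\sqrt 2 w = 2 (w / \sqrt 2)$ are halved, both sides are
polynomials in the circular and hyperbolic functions of $w$ and $w / \sqrt 2$,
and they agree modulo the Pythagorean relations. *)
Lemma det_toeplitz w (r2 := Num.sqrt 2 : R) :
  32 * \det (toeplitz w) =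
    cos (r2 * w) + cosh (r2 * w) + 2 * cos w * cosh w
    + 3 * (cos (r2 * w) + cosh (r2 * w)) * cos w * cosh w
    + 8 * (cos w + cosh w) * cos (1 / r2 * w) * cosh (1 / r2 * w)
    + 4 * r2 * sin w * sin (1 / r2 * w) * cosh (1 / r2 * w)
    - 4 * r2 * cos (1 / r2 * w) * sinh w * sinh (1 / r2 * w)
    + 2 * r2 * sin w * sin (r2 * w) * cosh w
    - 2 * r2 * cos w * sinh w * sinh (r2 * w)
    + 6.
Proof.
have d2 : r2 ^+ 2 = 2 by rewrite sqr_sqrtr.
have -> : r2 * w = 2 * (1 / r2 * w).
  by rewrite /r2 inv_sqrt2 mulrA [2 * _]mulrC divfK.
rewrite cosh_double sinh_double [2 * (1 / r2 * w)]mulr_natl.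
rewrite cos_mulr2n sin_mulr2n.
pose F (i j : nat) := phi (i%:R - j%:R) w.
rewrite (_ : toeplitz w = \matrix_(i, j) F i j)// det_laplace.
rewrite /laplace /bump/= {}/F /phi/= -/r2.
have := cosh2sinh2 w; have := cosh2sinh2 (1 / r2 * w).
have := cos2sin2 w; have := cos2sin2 (1 / r2 * w).
move: (cosh _) (sinh _) (cos _) (sin _) (cosh w) (sinh w) (cos w) (sin w).
rewrite [1 / r2]inv_sqrt2 -/r2; move: r2 d2 => d d2 K H k h C S c s e1 e2 e3 e4.
by field: d2 e1 e2 e3 e4.
Qed.

End fundamental_solutions.

(** * Primitives, Taylor's formula and the cyclic differential system *)

Section calculus.
Context {R : realType}.
Implicit Types (f h : R -> R) (a b s t x p : R).
Local Notation leb := (@lebesgue_measure R).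

Lemma is_derive_continuous f x a : is_derive x 1 f a -> {for x, continuous f}.
Proof. by move=> fa; apply/differentiable_continuous/derivable1_diffP. Qed.

Lemma derive0_constant f a b s t :
  (forall x, a <= x <= b -> is_derive x 1 f 0) ->
  a <= s <= b -> a <= t <= b -> f s = f t.
Proof.
move=> df; wlog st : s t / s <= t => [H|] sab tab.
  by case: (leP s t) => [/H|/ltW /H] ->.
have stab x : x \in `[s, t] -> is_derive x 1 f 0.
  rewrite in_itv/= => /andP[sx xt]; apply: df.
  by case/andP: sab => sa _; case/andP: tab => _ tb; apply/andP; split; lra.
have cf : {within `[s, t], continuous f}.
  apply: continuous_in_subspaceT => x /set_mem xst.
  exact: is_derive_continuous (stab x xst).
have oo x : x \in `]s, t[ -> is_derive x 1 f 0.
  by move=> xst; apply: stab; exact: subset_itv_oo_cc.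
have [x _ /eqP] := @MVT_segment _ f (fun=> 0) s t st oo cf.
by rewrite mul0r subr_eq0 => /eqP.
Qed.

Lemma Rintegral_FTC2 f h a b : a <= b ->
  (forall x, is_derive x 1 f (h x)) -> continuous h ->
  \int[leb]_(x in `[a, b]) h x = f b - f a.
Proof.
move=> ab df ch; have cf x := is_derive_continuous (df x).
move: ab; rewrite le_eqVlt => /predU1P[->|ab].
  by rewrite set_itv1 Rintegral_set1 subrr.
rewrite /Rintegral (@continuous_FTC2 _ h f a b)//.
- exact: continuous_subspaceT.
- split; first by move=> x _; have := df x; case.
  + by apply: cvg_at_right_filter; exact: cf.
  + by apply: cvg_at_left_filter; exact: cf.
- by move=> x _; rewrite derive1E; have [_] := df x.
Qed.

Lemma continuous_integrable h a b : continuous h ->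
  leb.-integrable `[a, b] (EFin \o h).
Proof.
move=> ch; apply: continuous_compact_integrable; first exact: segment_compact.
exact: continuous_subspaceT.
Qed.

(** A primitive on the whole line: with two-sided derivatives everywhere, no
one-sided derivative is ever needed at the ends of $[0, 1]$. *)
Lemma continuous_primitive h a : continuous h ->
  exists2 f : R -> R, f a = 0 & forall x, is_derive x 1 f (h x).
Proof.
move=> ch; pose I u y := \int[leb]_(x in `[u, y]) h x.
have Ch u v y : u <= v <= y -> I u y - I u v = I v y.
  move=> /andP[uv vy]; rewrite [LHS]Rintegral_itvB ?bnd_simp//.
    rewrite Rintegral_itv_obnd_cbnd//.
    by apply: integrableS (continuous_integrable v y ch) => //;
      exact: subset_itv_oc_cc.
  exact: continuous_integrable.
(* The integral from a to y, for either order of a and y. *)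
pose f y := I (Num.min y a) y - I (Num.min y a) a.
have fE u y : u <= y -> u <= a -> f y = I u y - I u a.
  move=> uy ua; rewrite /f; set m := Num.min y a.
  have um : u <= m by rewrite le_min uy.
  rewrite -(Ch u m y); last by rewrite um ge_min lexx.
  rewrite -(Ch u m a); last by rewrite um ge_min lexx orbT.
  by ring.
exists f => [|x]; first by rewrite /f subrr.
(* Near x, the base point can be moved to a fixed point on the left. *)
pose u := Num.min x a - 1.
have ux : u < x by rewrite ltrBlDr ltr_pwDr// ge_min lexx.
have ua : u < a by rewrite ltrBlDr ltr_pwDr// ge_min lexx orbT.
apply: (@near_eq_is_derive _ _ _ (fun y => I u y - I u a)).
  near=> y; rewrite (fE u)//; last exact: ltW.
  by apply: ltW; near: y; exact: lt_nbhsr.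
have [dI dIE] : derivable (I u) x 1 /\ (I u)^`()%classic x = h x.
  apply: (@continuous_FTC1_closed _ h u x (x + 1)) => //.
  - by rewrite ltrDl.
  - exact: continuous_integrable.
  - exact: ch.
have dIx : is_derive x 1 (I u) (h x) by rewrite -dIE derive1E; exact: derivableP.
by apply: is_derive_eq; rewrite subr0.
Unshelve. all: by end_near. Qed.

Definition derivatives n (v : nat -> R -> R) :=
  forall i, (i < n)%N -> forall x, is_derive x 1 (v i) (v i.+1 x).

Lemma iterated_primitive n h a : continuous h -> exists v,
  [/\ derivatives n v, v n = h & forall i, (i < n)%N -> v i a = 0].
Proof.
move=> ch; elim: n => [|n [v [dv vn v0]]].
  by exists (fun=> h); split.
have cv : continuous (v 0%N).
  case: n dv vn {v0} => [|n] dv vn; first by rewrite vn.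
  by move=> x; apply: is_derive_continuous (dv 0%N isT x).
have [f f0 df] := continuous_primitive a cv.
exists (fun i => if i is j.+1 then v j else f); split => //.
- by case=> [|i] ni x; [exact: df|exact: dv].
- by case=> [|i] ni; [exact: f0|exact: v0].
Qed.

(** The derivative of the Taylor polynomial [T] with respect to its base point
telescopes to its last term. *)
Lemma taylor_integral v p a b : a <= b -> derivatives 4 v -> continuous (v 4%N) ->
  let T s := v 0%N s + (p - s) * v 1%N s + (p - s) ^+ 2 / 2 * v 2%N s
             + (p - s) ^+ 3 / 6 * v 3%N s in
  \int[leb]_(s in `[a, b]) ((p - s) ^+ 3 / 6 * v 4%N s) = T b - T a.
Proof.
move=> ab dv c4 T; apply: Rintegral_FTC2 => // x.
  rewrite /T.
  have d0 := dv 0%N isT x; have d1 := dv 1%N isT x.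
  have d2 := dv 2%N isT x; have d3 := dv 3%N isT x.
  by apply: is_derive_eq; rewrite /GRing.scale/=; field.
by apply: cvgM; [apply: (@is_derive_continuous (fun s => (p - s) ^+ 3 / 6) x)
                | exact: c4].
Qed.

End calculus.

Section cyclic_system.
Context {R : realType}.
Variables (w : R) (y : 'Z_8 -> R -> R).
Hypothesis dy : forall k (x : R), 0 <= x <= 1 ->
  is_derive x 1 (y k) (w * y (k + 1) x).

(** The right-hand side, as a function of $s$, has derivative
$w \sum_k (\varphi_k y_{j+k+1} - \varphi_{k-1} y_{j+k})$, which cancels by the
shift $k \mapsto k + 1$ of $\mathbb Z/8$; so it is constant, and at $s = t$ only
the term $k = 0$ remains. *)
Lemma propagation j s t : 0 <= s <= 1 -> 0 <= t <= 1 ->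
  y j t = \sum_k phi k (w * (t - s)) * y (j + k) s.
Proof.
move=> s01 t01; pose G x := \sum_k phi k (w * (t - x)) * y (j + k) x.
have <- : G t = y j t.
  rewrite /G subrr mulr0 (bigD1 0)//= phi0 mul1r addr0 big1 ?addr0// => k k0.
  by rewrite phi0 (negbTE k0) mul0r.
apply: (@derive0_constant _ G 0 1) => // x x01.
have -> : G = \sum_k (fun x => phi k (w * (t - x)) * y (j + k) x).
  by apply/funext => z; rewrite fct_sumE.
have dk k : is_derive x 1 (fun x => phi k (w * (t - x)) * y (j + k) x)
    (w * (phi k (w * (t - x)) * y (j + k + 1) x)
     - w * (phi (k - 1) (w * (t - x)) * y (j + k) x)).
  have dyk := dy (j + k) x01.
  by apply: is_derive_eq; rewrite /GRing.scale/=; ring.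
apply: is_derive_eq; rewrite sumrB -!mulr_sumr -mulrBr.
rewrite [X in _ - X](reindex_inj (addIr 1))/=.
under [X in _ - X]eq_bigr do rewrite addrK addrA.
by rewrite subrr mulr0.
Qed.

End cyclic_system.

(** * The fourfold integration operator and its adjoint *)

Section operators.
Context {R : realType}.
Implicit Types (x z : @L2_01 R) (h : R -> R) (v : nat -> R -> R).
Local Notation mu := (@leb01 R).
Local Notation T := (measurableTypeR R).

Lemma ae_on01 (P : R -> Prop) : (forall t : R, 0 <= t <= 1 -> P t) ->
  {ae mu, forall t, P t}.
Proof.
move=> P01; exists (~` `[0, 1]%classic); split.
- by apply: measurableC; exact: measurable_itv.
- by rewrite /= /leb01 /mfrestr /mrestr setICl measure0.
- by apply: subsetC => t /=; rewrite in_itv/=; exact: P01.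
Qed.

Lemma eq_on01_ae (f g : T -> R) : (forall t : R, 0 <= t <= 1 -> f t = g t) ->
  f = g %[ae mu].
Proof. by move=> fg; apply: ae_on01 => t t01 _; exact: fg. Qed.

Lemma bounded_Lfun (f : T -> R) M : measurable_fun setT f ->
  (forall t, `|f t| <= M) -> f \in Lfun mu 2%:E.
Proof.
move=> mf fM; rewrite inE; apply/andP; split; rewrite inE//=.
have : cst M \in Lfun mu 2%:E by exact: Lfun_cst.
rewrite inE => /andP[_]; rewrite inE/= /finite_norm; apply: le_lt_trans.
rewrite unlock; apply: gt0_ler_poweR.
- by rewrite invr_ge0.
- by rewrite in_itv/= leey andbT; apply: integral_ge0.
- by rewrite in_itv/= leey andbT; apply: integral_ge0.
apply: ge0_le_integral => //=.
- apply/measurable_EFinP.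
  apply: (@measurableT_comp _ _ _ _ _ _ (@powR R ^~ 2)) => //.
  exact: measurableT_comp.
- move=> s _; rewrite lee_fin ge0_ler_powR ?nnegrE//.
  by rewrite (le_trans (fM s))// ler_norm.
Qed.

Lemma continuous_L2 h : continuous h ->
  exists x, forall t : R, 0 <= t <= 1 -> (x : T -> R) t = h t.
Proof.
move=> ch; pose f : T -> R := h \_ `[0, 1].
have mf : measurable_fun setT f.
  apply/measurable_restrict => //.
  apply: measurable_funTS; exact: continuous_measurable_fun.
have [M fM] : exists M, forall t, `|f t| <= M.
  have [||c _ hc] := @EVT_max R (fun t => `|h t|) 0 1; first exact: ler01.
    by apply: continuous_subspaceT => t; apply: cvg_norm; exact: ch.
  exists `|h c| => t; rewrite /f patchE; case: ifPn => [|_].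
    by rewrite inE => t01; exact: hc.
  by rewrite normr0.
exists (Lfun_Sub _ (bounded_Lfun mf fM)) => t t01 /=.
by rewrite /f patchE mem_set//= in_itv.
Qed.

(** In [taylor_integral] on $[0, s]$ with $p = s$, the polynomial vanishes at 0 and
equals $v(s)$ at $s$. *)
Lemma J4_taylor x v : derivatives 4 v -> continuous (v 4%N) ->
  (forall i, (i < 4)%N -> v i 0 = 0) ->
  (forall t : R, 0 <= t <= 1 -> (x : T -> R) t = v 4%N t) ->
  forall s : R, 0 <= s <= 1 -> J4 x s = v 0%N s.
Proof.
move=> dv c4 v0 xv s s01; have /andP[s0 s1] := s01.
rewrite /= /J4_fun patchE mem_set/= ?in_itv//.
under eq_Rintegral => t.
  rewrite inE/= in_itv/= => /andP[t0 ts].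
  rewrite xv; last by rewrite t0 (le_trans ts).
  over.
by rewrite taylor_integral//= !v0//; ring.
Qed.

(** The same on $[t, 1]$ with $p = t$; the sign in $(s - t)^3 = - (t - s)^3$ is
absorbed by replacing $v$ with $-v$. *)
Lemma J4adj_taylor z v : derivatives 4 v -> continuous (v 4%N) ->
  (forall i, (i < 4)%N -> v i 1 = 0) ->
  (forall t : R, 0 <= t <= 1 -> (z : T -> R) t = v 4%N t) ->
  forall t : R, 0 <= t <= 1 -> J4adj z t = v 0%N t.
Proof.
move=> dv c4 v1 zv t t01; have /andP[t0 t1] := t01.
rewrite /= /J4adj_fun patchE mem_set/= ?in_itv//.
under eq_Rintegral => s.
  rewrite inE/= in_itv/= => /andP[ts s1].
  rewrite zv; last by rewrite s1 (le_trans _ ts).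
  rewrite -[s - t]opprB exprNn -signr_odd expr1 mulN1r mulNr mulNr -mulrN.
  over.
rewrite (@taylor_integral _ (fun i s => - v i s))//=.
- by rewrite !v1//; ring.
- by move=> i i4 s; have := dv i i4 s => ?; exact: is_deriveN.
- by move=> s; apply: cvgN; exact: c4.
Qed.

(** Existence of the fourfold primitive with zero data at 0, combined with its
uniqueness [J4_taylor], upgrades $J^4 x$ to a function with four derivatives
when $x$ is continuous. *)
Lemma J4_smooth x h : continuous h ->
  (forall t : R, 0 <= t <= 1 -> (x : T -> R) t = h t) ->
  exists v, [/\ derivatives 4 v, v 4%N = h, forall i, (i < 4)%N -> v i 0 = 0 &
    forall s : R, 0 <= s <= 1 -> J4 x s = v 0%N s].
Proof.
move=> ch xh; have [v [dv v4 v0]] := iterated_primitive 4 0 ch.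
by exists v; split=> //; apply: J4_taylor; rewrite ?v4.
Qed.

Lemma J4adj_smooth z h : continuous h ->
  (forall t : R, 0 <= t <= 1 -> (z : T -> R) t = h t) ->
  exists v, [/\ derivatives 4 v, v 4%N = h, forall i, (i < 4)%N -> v i 1 = 0 &
    forall t : R, 0 <= t <= 1 -> J4adj z t = v 0%N t].
Proof.
move=> ch xh; have [v [dv v4 v1]] := iterated_primitive 4 1 ch.
by exists v; split=> //; apply: J4adj_taylor; rewrite ?v4.
Qed.

(** The kernel of $J^4$ extended to all $s$ as a function that is continuous in
$s$, so that dominated convergence applies across the ends of $[0, 1]$. *)
Definition K4 (s t : R) : R :=
  if 0 <= t then Num.max 0 (s - t) ^+ 3 / 6 else 0.

Lemma J4_funK4 x (s : R) : s <= 1 -> J4_fun x s = \int[mu]_t (K4 s t * x t).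
Proof.
move=> s1; rewrite J4_funE; apply: eq_Rintegral => t _; congr (_ * _).
rewrite /J4_kernel /K4 s1 andbT; case: (0 <= t) => //=.
case: (leP t s) => ts; first by rewrite max_r ?subr_ge0.
by rewrite max_l ?expr0n ?mul0r// subr_le0 ltW.
Qed.

Lemma K4_le (s t : R) : `|K4 s t| <= `|s| ^+ 3 / 6.
Proof.
rewrite /K4; case: ifPn => t0; last by rewrite normr0 divr_ge0// exprn_ge0.
rewrite ger0_norm ?divr_ge0// ?exprn_ge0 ?le_max ?lexx// ler_pM2r//.
rewrite lerXn2r ?nnegrE// ?le_max ?lexx// ge_max normr_ge0/=.
by have := ler_norm s; lra.
Qed.

Lemma measurable_K4 (s : R) : measurable_fun [set: T] (K4 s).
Proof.
apply: measurable_fun_ifT => //; first exact: measurable_fun_ler.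
apply: measurable_funM => //; apply: measurable_funX.
by apply: measurable_maxr => //; exact: measurable_funB.
Qed.

Lemma continuous_K4 (t : R) : continuous (K4 ^~ t).
Proof.
move=> s; rewrite /K4; case: (0 <= t); last exact: cvg_cst.
apply: cvgM; last exact: cvg_cst.
apply: (@continuous_comp _ _ _ (fun s => Num.max 0 (s - t))
  (fun u => u ^+ 3)); last exact: exprn_continuous.
apply: (@continuous_max _ _ (cst 0) (fun s => s - t)); first exact: cvg_cst.
by apply: cvgB; [exact: cvg_id|exact: cvg_cst].
Qed.

Lemma integrable_dominated x (k : T -> R) M : measurable_fun setT k ->
  (forall t, `|k t| <= M) -> mu.-integrable setT (EFin \o (fun t => k t * x t)).
Proof.
move=> mk kM; have M0 : 0 <= M by rewrite (le_trans _ (kM 0)).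
have iM := integrableZl measurableT M (integrable_norm (L2_integrable x)).
apply: le_integrable iM => //; first exact/measurable_EFinP/measurable_funM.
move=> t _ /=; rewrite lee_fin normrM [X in _ <= X]normrM normr_id.
by rewrite ler_wpM2r// (le_trans (kM t))// ler_norm.
Qed.

(** The first step of the regularity of eigenfunctions: $x$ is only
square-integrable, but the kernel is continuous and locally bounded in $s$. *)
Lemma continuous_J4 x : exists2 h, continuous h &
  forall s : R, 0 <= s <= 1 -> J4 x s = h s.
Proof.
exists (fun s => \int[mu]_t (K4 s t * x t)); last first.
  by move=> s /andP[_ s1]; exact: J4_funK4.
move=> a; pose M := (`|a| + 1) ^+ 3 / 6.
have KM s t : s \in `]a - 1, a + 1[ -> `|K4 s t * x t| <= `|M * x t|.
  rewrite in_itv/= => /andP[as_ sa]; rewrite normrM [X in _ <= X]normrM.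
  rewrite ler_wpM2r// (le_trans (K4_le s t))// (le_trans _ (ler_norm _))//.
  rewrite ler_pM2r// lerXn2r ?nnegrE ?addr_ge0//.
  rewrite ler_norml; have := ler_norm a; have := ler_norm (- a).
  by rewrite normrN; lra.
apply: (@continuity_under_integral R _ _ mu (fun s t => K4 s t * x t) setT
  measurableT (a - 1) (a + 1) _ _ (fun t => `|M * x t|)) => //.
- move=> s _; exact: integrable_dominated (measurable_K4 s) (K4_le s).
- apply: aeW => t _ s _; apply: cvgM; last exact: cvg_cst.
  exact: continuous_K4.
- by apply: integrable_norm; apply: (@integrable_dominated x (cst M) `|M|).
- by move=> s sa; apply: aeW => t _; exact: KM.
- by rewrite inE/= in_itv/=; apply/andP; split; lra.
Qed.

End operators.

(** * From a singular Toeplitz matrix to an eigenfunction *)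

Section eigenfunctions.
Context {R : realType}.
Implicit Types (x z f : @L2_01 R) (v : nat -> R -> R).
Local Notation mu := (@leb01 R).
Local Notation T := (measurableTypeR R).

Lemma derivatives_eq0 n v : derivatives n v ->
  (forall t : R, 0 < t < 1 -> v 0%N t = 0) ->
  forall i, (i <= n)%N -> forall t : R, 0 < t < 1 -> v i t = 0.
Proof.
move=> dv v0; elim=> [//|i IH] ni t t01.
have d0 : is_derive t 1 (v i) 0.
  apply: (@near_eq_is_derive _ _ _ (cst 0)).
  have t01' : t \in `]0, 1[ by rewrite in_itv.
  near=> s; rewrite IH ?(ltnW ni)//.
  have : s \in `]0, 1[ by near: s; exact: near_in_itvoo.
  by rewrite in_itv.
by have [_ <-] := dv i ni t; have [_ ->] := d0.
Unshelve. all: by end_near. Qed.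

Lemma derivatives0 n : derivatives n (fun _ => cst 0 : R -> R).
Proof. by move=> i _ t; exact: is_derive_cst. Qed.

Lemma J4_0 (s : R) : 0 <= s <= 1 -> J4 0 s = 0.
Proof.
by move=> s01; rewrite (J4_taylor (@derivatives0 4))//; exact: cst_continuous.
Qed.

Lemma J4adj_0 (s : R) : 0 <= s <= 1 -> J4adj 0 s = 0.
Proof.
by move=> s01; rewrite (J4adj_taylor (@derivatives0 4))//; exact: cst_continuous.
Qed.

Lemma val_Zp8 k : (k < 8)%N -> (k%:R : 'Z_8) = k :> nat.
Proof. by move=> k8; rewrite val_Zp_nat// modn_small. Qed.

(** A vector $c$ in the left kernel is taken as initial value $y_k(0)$, $k < 4$, of
the solution of the cyclic system whose other initial values are zero; then
$J^4 y_0 = w^{-4} y_4$ and $(J^4)^* y_4 = w^{-4} y_0$. *)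
Lemma det0_eigenvalue (w : R) : w != 0 -> \det (toeplitz w) = 0 ->
  is_eigenvalue (@J4adj R \o J4) (w ^- 8).
Proof.
move=> w0 /eqP/det0P[c c0 cA].
pose y (j : 'Z_8) (t : R) : R :=
  \sum_(k < 4) c 0 k * phi ((k : nat)%:R - j) (w * t).
have dy j (t : R) : is_derive t 1 (y j) (w * y (j + 1) t).
  have -> : y j = \sum_(k < 4) (fun t => c 0 k * phi ((k : nat)%:R - j) (w * t)).
    by apply/funext => z; rewrite fct_sumE.
  apply: is_derive_eq; rewrite mulr_sumr; apply: eq_bigr => k _.
  by rewrite /GRing.scale/= mulr1 opprD addrA; ring.
have y0 (j : 'Z_8) : y j 0 = if (j < 4)%N then c 0 (inord j) else 0.
  have phiE (k : 'I_4) : phi ((k : nat)%:R - j) (w * 0) = (k == j :> nat)%:R.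
    by rewrite mulr0 phi0 subr_eq0 -val_eqE/= val_Zp8// (ltn_trans (ltn_ord k)).
  rewrite /y; case: ifPn => [j4|j4].
    rewrite (bigD1 (inord j))//= phiE inordK// eqxx mulr1 big1 ?addr0// => k kj.
    rewrite phiE (_ : _ == _ = false) ?mulr0//; apply: contraNF kj => /eqP kj.
    by rewrite -val_eqE/= inordK// kj.
  rewrite big1// => k _; rewrite phiE (_ : _ == _ = false) ?mulr0//.
  by apply: contraNF j4 => /eqP <-.
have y1 (j : 'I_4) : y (j : nat)%:R 1 = 0.
  have /rowP/(_ j) := cA; rewrite !mxE => yj; rewrite -[RHS]yj.
  by apply: eq_bigr => k _; rewrite mxE mulr1.
have w40 : w ^+ 4 != 0 by rewrite expf_neq0.
(* Starting from the index a, the family is a chain of derivatives; the factor b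
   normalizes it. *)
pose v a b i (t : R) : R := w ^+ i * (b * y ((a + i)%:R) t).
have dv n a b : derivatives n (v a b).
  move=> i _ t; have := dy (a + i)%:R t => dyi.
  by apply: is_derive_eq; rewrite /v /GRing.scale/= addnS natr1 exprSr; ring.
have cy j : continuous (y j) by move=> t; exact: is_derive_continuous (dy j t).
have cv n a b : continuous (v a b n).
  by move=> t; exact: is_derive_continuous (dv n.+1 a b n (ltnSn n) t).
have [x xy] := continuous_L2 (cy 0).
have Jx (s : R) : 0 <= s <= 1 -> J4 x s = w ^- 4 * y 4 s.
  move=> s01; rewrite (@J4_taylor _ x (v 4%N (w ^- 4)))//.
  - by rewrite /v expr0 mul1r addn0.
  - move=> i i4; rewrite /v y0 val_Zp8 ?ltn_add2l// ltnNge leq_addr/= !mulr0//.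
  - by move=> t t01; rewrite xy// /v mulVKf//; congr (y _ t); apply/val_inj.
have JJx (s : R) : 0 <= s <= 1 -> J4adj (J4 x) s = w ^- 8 * y 0 s.
  move=> s01; rewrite (@J4adj_taylor _ (J4 x) (v 0%N (w ^- 8)))//.
  - by rewrite /v expr0 mul1r addn0.
  - by move=> i i4; rewrite /v (y1 (Ordinal i4)) !mulr0.
  - by move=> t t01; rewrite Jx// /v add0n; field.
exists x; split; last first.
  apply: eq_on01_ae => t t01; rewrite JJx// -xy//.
(* If $y_0$ vanished almost everywhere, then $(J^4)^* J^4 y_0 = w^{-8} y_0$ would
   vanish at every point of [0, 1], and so would all the $y_j$ at 1/2, an interior
   point; propagating from 1/2 to 0 gives $c = 0$. *)
move=> x0; move/negP: c0; apply; apply/eqP.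
have y00 (t : R) : 0 <= t <= 1 -> y 0 t = 0.
  move=> t01; have /eqP : J4adj (J4 x) t = 0.
    rewrite (J4_ae_eq x0) (@J4adj_ae_eq _ _ 0) ?J4adj_0//.
    by apply: eq_on01_ae => s s01; exact: J4_0.
  rewrite JJx// mulf_eq0 invr_eq0 expf_eq0 (negbTE w0)/=.
  by move/eqP.
have yh (j : 'Z_8) : y j (1 / 2) = 0.
  have /eqP : v 0%N 1 j (1 / 2) = 0.
    apply: (derivatives_eq0 (dv 8%N 0%N 1) _ (ltnW (ltn_ord j))); last lra.
    by move=> t /andP[t0 t1]; rewrite /v y00 ?mulr0// !ltW.
  rewrite /v add0n natr_Zp mul1r.
  by rewrite mulf_eq0 expf_eq0 (negbTE w0) andbF/= => /eqP.
apply/rowP => j; rewrite mxE.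
have := y0 (j : nat)%:R.
rewrite (@propagation _ w y (fun k t _ => dy k t) _ (1 / 2)); [|lra|lra].
rewrite big1; last by move=> k _; rewrite yh mulr0.
have j8 : (j < 8)%N by exact: ltn_trans (ltn_ord j) _.
by rewrite val_Zp8// ltn_ord inord_val => <-.
Qed.

End eigenfunctions.

(** * From an eigenfunction to a singular Toeplitz matrix *)

Section converse.
Context {R : realType}.
Implicit Types (x z f : @L2_01 R).
Local Notation mu := (@leb01 R).
Local Notation T := (measurableTypeR R).

Lemma integrable_sqr f : mu.-integrable setT (EFin \o (fun t => f t ^+ 2)).
Proof.
have /Lfun_integrable := LfunP f.
move=> /(_ (lee1n 2)); apply: eq_integrable => // t _ /=.
by rewrite powR_mulrn// real_normK// num_real.
Qed.

(** $\lambda \|f\|^2 = \langle f, (J^4)^* J^4 f \rangle = \|J^4 f\|^2$. *)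
Lemma eigenvalue_ge0 f (lambda : R) : ~ f = (0 : L2_01) %[ae mu] ->
  J4adj (J4 f) = lambda *: f %[ae mu] -> 0 <= lambda.
Proof.
move=> f0 ef; rewrite leNgt; apply/negP => l0; apply: f0.
have if2 := integrable_sqr f.
have nJ : 0 <= lambda * \int[mu]_t (f t ^+ 2).
  have <- : inner (J4 f) (J4 f) = lambda * \int[mu]_t (f t ^+ 2).
    rewrite J4_adjoint -RintegralZl// /inner /Rintegral; congr fine.
    apply: ae_eq_integral => //.
    - by apply/measurable_EFinP; apply: measurable_funM.
    - apply/measurable_EFinP; apply: measurable_funM => //.
      exact: measurable_funX.
    - apply: filterS ef => t /(_ I) e _; congr EFin.
      transitivity (f t * (lambda * f t)); first by congr (_ * _); exact: e.
      by ring.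
  by apply: Rintegral_ge0 => t _; rewrite -expr2 sqr_ge0.
have int0 : \int[mu]_t (f t ^+ 2) = 0.
  apply/eqP; rewrite eq_le; apply/andP; split; last first.
    by apply: Rintegral_ge0 => t _; exact: sqr_ge0.
  by rewrite -(nmulr_rge0 _ l0).
have /ae_eq_integral_abs : measurable_fun [set: T] (EFin \o (fun t => f t ^+ 2)).
  exact: measurable_int if2.
move=> /(_ mu measurableT)[+ _].
have -> : (\int[mu]_x `|(EFin \o (fun t => f t ^+ 2)%R) x| = 0)%E.
  transitivity (\int[mu]_x (f x ^+ 2)%R%:E)%E.
    by apply: eq_integral => t _ /=; rewrite ger0_norm// sqr_ge0.
  by rewrite -[LHS]fineK ?(integrable_fin_num _ if2)// [X in X%:E]int0.
move=> /(_ erefl); apply: filterS => t /(_ I) /= [] /eqP.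
by rewrite sqrf_eq0 => /eqP.
Qed.

(** With $\lambda g = (J^4)^* J^4 f = u$, where $u'''' = J^4 f = J^4 g = v$ and
$v'''' = g = \lambda^{-1} u$, the functions $u, ..., u''', v, ..., v'''$, rescaled
by powers of $w$, form a cyclic system on $[0, 1]$. Its values $a$ at 0 of indices
below 4 determine it, and they satisfy four linear equations at 1. *)
Lemma eigenfunction_det0 f (w lambda : R) : w ^+ 8 = lambda^-1 -> w != 0 ->
  ~ f = (0 : L2_01) %[ae mu] ->
  J4adj (J4 f) = lambda *: f %[ae mu] -> \det (toeplitz w) = 0.
Proof.
move=> w8 w0 f0 ef; have l0 : lambda != 0.
  by rewrite -invr_eq0 -w8 expf_neq0.
(* A representative of f given by the equation itself at every point. *)
pose g : L2_01 := lambda^-1 *: J4adj (J4 f).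
have fg : f = g %[ae mu].
  apply: filterS ef => t /(_ I) e _.
  transitivity (lambda^-1 * (lambda * f t)); first by rewrite mulKf.
  by congr (_ * _); apply/esym; exact: e.
have [V cV JV] := continuous_J4 f.
have [u [du u4 u1 Ju]] := J4adj_smooth cV JV.
have gu (t : R) : 0 <= t <= 1 -> g t = lambda^-1 * u 0%N t.
  by move=> t01; rewrite -Ju.
have cu : continuous (fun t => lambda^-1 * u 0%N t).
  move=> t; apply: cvgM; first exact: cvg_cst.
  exact: is_derive_continuous (du 0%N isT t).
have [v [dv v4 v0 Jv]] := J4_smooth cu gu.
have uv (t : R) : 0 <= t <= 1 -> u 4%N t = v 0%N t.
  by move=> t01; rewrite u4 -JV// (J4_ae_eq fg) Jv.
pose y (k : 'Z_8) t : R :=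
  w ^- k * (if (k < 4)%N then u k t else v (k - 4)%N t).
have dy k (t : R) : 0 <= t <= 1 -> is_derive t 1 (y k) (w * y (k + 1) t).
  move=> t01; rewrite /y.
  have d0 := du 0%N isT t; have d1 := du 1%N isT t.
  have d2 := du 2%N isT t; have d3 := du 3%N isT t.
  have e0 := dv 0%N isT t; have e1 := dv 1%N isT t.
  have e2 := dv 2%N isT t; have e3 := dv 3%N isT t.
  have wS n : w ^- n = w * w ^- n.+1 by rewrite exprS invfM mulVKf.
  case: k => [] [|[|[|[|[|[|[|[|//]]]]]]]] i /=; apply: is_derive_eq;
    by rewrite ?uv// ?v4 -?w8 /GRing.scale/=; field.
have y0 (m : 'Z_8) : (4 <= m)%N -> y m 0 = 0.
  by move=> m4; rewrite /y ltnNge m4/= v0 ?mulr0// ltn_subLR// ltn_ord.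
have y1 (j : 'I_4) : y (j : nat)%:R 1 = 0.
  have j8 : (j < 8)%N by exact: ltn_trans (ltn_ord j) _.
  by rewrite /y val_Zp8// ltn_ord u1 ?mulr0.
pose a : 'rV[R]_4 := \row_k y (k : nat)%:R 0.
have aM : a *m toeplitz w = 0.
  apply/rowP => j; rewrite [RHS]mxE -[RHS](y1 j).
  rewrite [RHS](@propagation _ w y dy _ 0); [|lra|lra].
  rewrite subr0 mulr1 (reindex_inj (addIr (- (j : nat)%:R)))/=.
  under eq_bigr do rewrite subrKC.
  rewrite (@big_split_ord _ _ _ 4 4) /= [X in _ = _ + X]big1 => [|m _].
    rewrite addr0 mxE; apply: eq_bigr => k _; rewrite !mxE mulrC.
    have -> : lshift 4 k = (k : nat)%:R :> 'Z_8.
      by apply/val_inj; rewrite /= val_Zp8// (ltn_trans (ltn_ord k)).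
    by [].
  by rewrite y0 ?mulr0//= leq_addr.
(* If a = 0, all the initial values vanish, and then so does f. *)
have [a0|a0] := eqVneq a 0; last by apply/eqP/det0P; exists a.
exfalso; apply: f0; apply: ae_eq_trans fg _; apply: eq_on01_ae => t t01.
have -> : g t = lambda^-1 * y 0 t by rewrite /y expr0 invr1 mul1r gu.
rewrite (@propagation _ w y dy _ 0)//; last lra.
rewrite big1 ?mulr0// => k _; rewrite add0r; have [k4|k4] := ltnP k 4; last first.
  by rewrite y0 ?mulr0.
have /rowP/(_ (Ordinal k4)) := a0; rewrite !mxE /= natr_Zp => ->.
by rewrite mulr0.
Qed.

End converse.

(** * Injectivity *)

Section injectivity.
Context {R : realType}.
Implicit Types (f : @L2_01 R) (k : R -> R -> R).
Local Notation mu := (@leb01 R).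
Local Notation leb := (@lebesgue_measure R).
Local Notation T := (measurableTypeR R).

(** $J^4$ maps $(J^4)^* J^4 f$, which is almost everywhere zero, to the zero
function; as $J^4 f$ is continuous, it is recovered from this function by
differentiating eight times. *)
Lemma J4adjJ4_eq0 f : J4adj (J4 f) = (0 : L2_01) %[ae mu] ->
  forall s : R, 0 < s < 1 -> J4 f s = 0.
Proof.
move=> JJf0 s s01.
have oo_cc (t : R) : 0 < t < 1 -> 0 <= t <= 1.
  by move=> /andP[t0 t1]; rewrite !ltW.
have [V cV JV] := continuous_J4 f.
have [v [dv v4 v1 Jv]] := J4adj_smooth cV JV.
have cv : continuous (v 0%N).
  by move=> t; exact: is_derive_continuous (dv 0%N isT t).
have [u [du u4 u0 Ju]] := J4_smooth cv Jv.
rewrite JV ?oo_cc// -v4; apply: (derivatives_eq0 dv) => // {s s01} s s01.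
rewrite -u4; apply: (derivatives_eq0 du) => // {s s01} s s01.
by rewrite -Ju ?oo_cc// (J4_ae_eq JJf0) J4_0 ?oo_cc.
Qed.

Definition backward_difference (h : R) k (s t : R) := (k s t - k (s - h) t) / h.

(** There is no lower bound on $s$, so that the property passes to backward
differences. *)
Definition annihilates f k := forall s : R, s < 1 ->
  mu.-integrable setT (EFin \o (fun t => k s t * f t)) /\
  \int[mu]_t (k s t * f t) = 0.

Lemma annihilates_difference f k (h : R) : 0 < h -> annihilates f k ->
  annihilates f (backward_difference h k).
Proof.
move=> h0 kf s s1.
have sh1 : s - h < 1 by lra.
have [i1 I1] := kf s s1; have [i2 I2] := kf (s - h) sh1.
have E : (fun t => backward_difference h k s t * f t) =
         (fun t => h^-1 * (k s t * f t - k (s - h) t * f t)).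
  by apply/funext => t; rewrite /backward_difference; ring.
have iB := integrableB measurableT i1 i2.
split; first by rewrite E; have := integrableZl measurableT h^-1 iB.
by rewrite E RintegralZl// RintegralB// I1 I2 subrr mulr0.
Qed.

Lemma annihilates_K4 f : (forall s : R, 0 < s < 1 -> J4 f s = 0) ->
  annihilates f K4.
Proof.
move=> Jf s s1; split.
  exact: integrable_dominated (measurable_K4 s) (K4_le s).
have [s0|s0] := ltP 0 s; first by rewrite -J4_funK4 ?ltW//; apply: Jf; rewrite s0.
transitivity (\int[mu]_t (0 : R)); last by rewrite /Rintegral integral0.
apply: eq_Rintegral => t _; rewrite /K4; case: ifPn => t0; last by rewrite mul0r.
by rewrite max_l ?expr0n ?mul0r// subr_le0 (le_trans s0).
Qed.

(** As $\partial_s^3 (s-t)_+^3 / 6$ is the indicator of $t < s$, this third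
difference is an approximation of that indicator, exact outside $[s - 3h, s]$. *)
Definition smoothed_step (h : R) :=
  iter 3 (backward_difference h) K4.

Lemma smoothed_stepE (h s t : R) : h != 0 -> smoothed_step h s t =
  (K4 s t - 3 * K4 (s - h) t + 3 * K4 (s - 2 * h) t - K4 (s - 3 * h) t) / h ^+ 3.
Proof.
move=> h0; rewrite /smoothed_step /= /backward_difference.
rewrite (_ : s - h - h = s - 2 * h); last by ring.
rewrite (_ : s - 2 * h - h = s - 3 * h); last by ring.
by field.
Qed.

Lemma smoothed_step0 (h s t : R) : 0 < h -> ~~ (0 <= t < s) ->
  smoothed_step h s t = 0.
Proof.
move=> h0 ts; rewrite smoothed_stepE ?gt_eqF//.
have K0 (i : R) : 0 <= i -> K4 (s - i * h) t = 0.
  move=> i0; rewrite /K4; case: ifPn => // t0; rewrite max_l ?expr0n ?mul0r//.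
  move: ts; rewrite t0/= -leNgt subr_le0 => st; apply: le_trans st.
  by rewrite gerBl mulr_ge0// ltW.
have := K0 0 (lexx _); have := K0 1 ler01; rewrite mul0r mul1r subr0 => -> ->.
by rewrite !K0//; ring.
Qed.

Lemma smoothed_step1 (h s t : R) : 0 < h -> 0 <= t <= s - 3 * h ->
  smoothed_step h s t = 1.
Proof.
move=> h0 /andP[t0 ts]; rewrite smoothed_stepE ?gt_eqF// /K4 t0 !max_r; try lra.
by field; rewrite gt_eqF.
Qed.

(** In the transition zone $s - 3h < t < s$ each of the kernels in
[smoothed_stepE] is at most $(3h)^3 / 6 = 9 h^3 / 2$, and the coefficients of the
same sign add up to 4. *)
Lemma smoothed_step_bounded (h s t : R) : 0 < h -> `|smoothed_step h s t| <= 18.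
Proof.
move=> h0; have [ts|] := boolP (0 <= t < s); last first.
  by move=> ts; rewrite smoothed_step0// normr0.
have [t3|t3] := leP t (s - 3 * h).
  by rewrite smoothed_step1 ?normr1 ?ler1n//; case/andP: ts => ->.
have K3 (i : R) : 0 <= i -> 0 <= K4 (s - i * h) t <= 9 / 2 * h ^+ 3.
  move=> i0; have := mulr_ge0 i0 (ltW h0) => ih.
  rewrite /K4; case: ifPn => [t0|_]; last first.
    by rewrite lexx mulr_ge0 ?exprn_ge0// ltW.
  have m0 : 0 <= Num.max 0 (s - i * h - t) by rewrite le_max lexx.
  rewrite divr_ge0 ?exprn_ge0//= ler_pdivrMr//.
  apply: (@le_trans _ _ ((3 * h) ^+ 3)).
    have h3 : 0 <= 3 * h by lra.
    by rewrite lerXn2r ?nnegrE// ge_max; apply/andP; split; lra.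
  by rewrite le_eqVlt; apply/orP; left; apply/eqP; field.
have := K3 0 (lexx _); have := K3 1 ler01; have := K3 2 (ler0n _ _).
have := K3 3 (ler0n _ _); rewrite mul0r mul1r subr0.
have H0 : 0 < h ^+ 3 by rewrite exprn_gt0.
rewrite smoothed_stepE ?gt_eqF// normrM normfV (gtr0_norm H0) ler_pdivrMr//.
by rewrite ler_norml; move: (h ^+ 3) => H *; lra.
Qed.

Lemma measurable_step f (s : R) :
  measurable_fun setT (fun t : T => if 0 <= t < s then f t else 0).
Proof.
apply: measurable_fun_ifT => //; apply: measurable_and.
  exact: measurable_fun_ler.
exact: measurable_fun_ltr.
Qed.

(** Dominated convergence for the steps of width $h = 1 / (n + 1)$, with the bound
of [smoothed_step_bounded]. *)
Lemma annihilates_step f : annihilates f K4 -> forall s : R, s < 1 ->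
  \int[mu]_t (if 0 <= t < s then f t else 0) = 0.
Proof.
move=> fK4 s s1; pose h n : R := n.+1%:R^-1.
have h0 n : 0 < h n by rewrite invr_gt0.
pose D n t := smoothed_step (h n) s t.
have DK n : annihilates f (smoothed_step (h n)).
  by rewrite /smoothed_step /=; do 3 apply: annihilates_difference => //.
have [|||||_ _ cvgD] := @dominated_convergence _ T R mu setT measurableT
  (fun n t => (D n t * f t)%:E) (fun t => (if 0 <= t < s then f t else 0)%:E)
  (fun t => `|18 * f t|%:E).
- by move=> n; have [/measurable_int] := DK n s s1.
- by apply/measurable_EFinP; exact: measurable_step.
- apply: aeW => t _; apply: cvg_near_cst.
  have [ts|ts] := boolP (0 <= t < s); last first.
    by near=> n; rewrite /D smoothed_step0// mul0r.
  have ts3 : 0 < (s - t) / 3 by case/andP: ts => _ ts; rewrite divr_gt0 ?subr_gt0.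
  near=> n; rewrite /D smoothed_step1 ?mul1r//; case/andP: ts => -> _ /=.
  have : h n < (s - t) / 3 by near: n; exact: (near_infty_natSinv_lt (PosNum ts3)).
  by move: (h n) => H; lra.
- apply: integrable_norm.
  apply: (@integrable_dominated _ f (cst 18) 18); first exact: measurable_cst.
  by move=> t; rewrite ger0_norm.
- apply: aeW => t n _; rewrite /= lee_fin normrM [X in _ <= X]normrM.
  rewrite ler_wpM2r// (le_trans (smoothed_step_bounded _ _ (h0 n)))//.
  exact: ler_norm.
rewrite /Rintegral.
have -> : (\int[mu]_t (if (0 <= t < s)%R then f t else 0%R)%:E = 0)%E.
  apply: cvg_unique cvgD _; first exact: ereal_hausdorff.
  apply: cvg_near_cst; near=> n.
  have [i0 I0] := DK n s s1.
  by rewrite -[LHS]fineK ?(integrable_fin_num _ i0)// [X in X%:E]I0.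
by [].
Unshelve. all: by end_near. Qed.

Lemma ae_leb01_lebesgue (P : R -> Prop) :
  {ae leb, forall t, P t} -> {ae mu, forall t, P t}.
Proof.
move=> [N [mN N0 PN]]; exists N; split=> //.
rewrite /= /leb01 /mfrestr /mrestr.
apply/eqP; rewrite eq_le measure_ge0 andbT -N0.
apply: le_measure; rewrite ?inE//; exact: measurableI.
Qed.

Lemma L2_lebesgue_integrable f : leb.-integrable `[0, 1] (EFin \o f).
Proof.
have /integrableP[mf fi] := L2_integrable f.
apply/integrableP; split; first exact: measurable_funTS.
apply: le_lt_trans fi.
have <- : (\int[mu]_(x in `[0%R, 1%R]) `|(EFin \o f) x| =
    \int[leb]_(x in `[0%R, 1%R]) `|(EFin \o f) x|)%E.
  apply: eq_measure_integral => A mA A01.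
  by rewrite /= /leb01 /mfrestr /mrestr setIidl.
by apply: ge0_subset_integral => //; exact: measurableT_comp.
Qed.

(** All the integrals of $f$ over $[0, s]$ with $s < 1$ vanish, and $f$ is the
derivative of its integral almost everywhere. *)
Lemma J4adjJ4_injective f : J4adj (J4 f) = (0 : L2_01) %[ae mu] ->
  f = (0 : L2_01) %[ae mu].
Proof.
move=> /J4adjJ4_eq0/annihilates_K4/annihilates_step fstep.
have if01 := L2_lebesgue_integrable f.
pose f0 : R -> R := f \_ `[0, 1].
have m01 : measurable (`[0, 1]%classic : set T) by exact: measurable_itv.
have lf0 := integrable_locally_restrict m01 if01.
have if0 : leb.-integrable setT (EFin \o f0).
  by rewrite /f0 -restrict_EFin; apply/integrable_restrict => //; rewrite setTI.
have if0y y : leb.-integrable `]-oo, y] (EFin \o f0) by exact: integrableS if0.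
pose F (x : R) := \int[leb]_(t in `]-oo, x]) f0 t.
have /ae_leb01_lebesgue dF := FTC1Ny if0y lf0.
have F0 (s : R) : 0 < s < 1 -> F s = 0.
  move=> /andP[s0 s1]; rewrite -[RHS](fstep s s1) leb01_lebesgue; last first.
    exact: measurable_step.
  rewrite /F -Rintegral_itv_bndo_bndc; last first.
    by apply: integrableS if0.
  rewrite Rintegral_mkcond [RHS]Rintegral_mkcond; apply: eq_Rintegral => t _.
  rewrite /f0 !patchE !mem_setE !in_itv/=.
  case: (leP 0 t) => t0 /=; last by rewrite if_same.
  by case: ltP => ts; case: ifP.
(* The end points, where [F0] does not determine the derivative of F. *)
have ne (c : R) : {ae mu, forall t : R, t != c}.
  apply: ae_leb01_lebesgue; exists [set c]; split => //.
    exact: lebesgue_measure_set1.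
  by move=> t /= /negP; rewrite negbK => /eqP.
have in01 : {ae mu, forall t : R, 0 <= t <= 1} by exact: ae_on01.
have ne01 : {ae mu, forall t : R, t != 0 /\ t != 1}.
  exact: (@filterI _ _ (ae_filter_ringOfSetsType mu) _ _ (ne 0) (ne 1)).
have aeF := ae_filter_ringOfSetsType mu.
apply: filterS3 ne01 in01 dF => t [t0 t1] /andP[t0' t1'] [_ dFt] _ /=.
have t01 : t \in `]0, 1[ by rewrite in_itv/= !lt_neqAle eq_sym t0 t1 t0' t1'.
have -> : f t = f0 t by rewrite /f0 patchE mem_set//= in_itv/= t0' t1'.
rewrite -dFt derive1E -(@near_eq_derive _ _ _ (cst 0)) ?derive_cst//.
near=> s; rewrite -/(F s) F0//.
have : s \in `]0, 1[ by near: s; exact: near_in_itvoo.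
by rewrite in_itv.
Unshelve. all: by end_near. Qed.

End injectivity.

(** * The characteristic equation *)

Theorem corollary2 (R : realType) (lambda : R) :
  is_eigenvalue (J4adj \o J4) lambda <->
  0 < lambda /\
  let w := lambda `^ (- (1 / 8)) in
  let r2 := Num.sqrt 2 : R in
    cos (r2 * w) + cosh (r2 * w) + 2 * cos w * cosh w
    + 3 * (cos (r2 * w) + cosh (r2 * w)) * cos w * cosh w
    + 8 * (cos w + cosh w) * cos (1 / r2 * w) * cosh (1 / r2 * w)
    + 4 * r2 * sin w * sin (1 / r2 * w) * cosh (1 / r2 * w)
    - 4 * r2 * cos (1 / r2 * w) * sinh w * sinh (1 / r2 * w)
    + 2 * r2 * sin w * sin (r2 * w) * cosh w
    - 2 * r2 * cos w * sinh w * sinh (r2 * w)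
    + 6 = 0.
Proof.
cbv zeta; rewrite -det_toeplitz; set w := lambda `^ _.
have w0 : 0 < lambda -> w != 0 by move=> l0; rewrite gt_eqF// powR_gt0.
have w8 : 0 < lambda -> w ^+ 8 = lambda^-1.
  move=> l0; rewrite -powR_mulrn ?powR_ge0// -powRrM.
  by rewrite (_ : _ * _ = -1) ?powR_inv1 ?ltW//; field.
split=> [[f [f0 ef]]|[l0 d0]].
- have l0 : 0 < lambda.
    rewrite lt_neqAle (eigenvalue_ge0 f0 ef) andbT eq_sym.
    apply: contra_notN f0 => /eqP l0; apply: J4adjJ4_injective.
    by move: ef; rewrite l0 scale0r.
  by split=> //; rewrite (eigenfunction_det0 (w8 l0) (w0 l0) f0 ef) mulr0.
- rewrite -[lambda]invrK -w8//; apply: det0_eigenvalue; first exact: w0.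
  by move/eqP: d0; rewrite mulf_eq0 => /orP[/eqP d0|/eqP//]; lra.
Qed.
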